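(* Let $n\ge1$, let $\mathcal{E}$ be a Hilbert space, let $L\in\mathcal{B}(\mathcal{E},\mathcal{F}^2_n\otimes\mathcal{E})$, and suppose that $(W_L,S^{\mathcal{E}})$ is an isometric Fock representation of $O_n$. Then $(W_L,S^{\mathcal{E}})$ is a Nica-covariant representation of $O_n$ if and only if $L\mathcal{E}\subseteq\Omega\otimes\mathcal{E}$.
   Context: All Hilbert spaces are complex and separable. $F_n^+$ is the free semigroup on letters $g_1,\dots,g_n$ with identity $g_0$. The Fock space is $\mathcal{F}^2_n=\mathbb{C}\Omega\oplus\bigoplus_{k\ge1}(\mathbb{C}^n)^{\otimes k}$ with vacuum unit vector $\Omega$; $\{e_1,\dots,e_n\}$ is the standard basis of $\mathbb{C}^n$; $e_\mu=e_{\mu_1}\otimes\cdots\otimes e_{\mu_k}$ for $\mu=g_{\mu_1}\cdots g_{\mu_k}$ and $e_{g_0}=\Omega$; the $e_\mu$ form an orthonormal basis. The creation operators are $S_if=e_i\otimes f$, and $S^{\mathcal{E}}=(S_1\otimes I_{\mathcal{E}},\dots,S_n\otimes I_{\mathcal{E}})$. The vector $e_1^{\otimes m}\otimes L\eta$ means $(S_1^m\otimes I_{\mathcal{E}})L\eta$. Odometer map: for $L\in\mathcal{B}(\mathcal{E},\mathcal{F}^2_n\otimes\mathcal{E})$, $W_L$ is the linear map on the dense linear span of $\{e_\mu\otimes\eta:\mu\in F_n^+,\eta\in\mathcal{E}\}$ given by $W_L(\Omega\otimes\eta)=L\eta$; $W_L(e_n^{\otimes m}\otimes\eta)=e_1^{\otimes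 m}\otimes L\eta$ for $m\ge1$; and $W_L(e_n^{\otimes j}\otimes e_i\otimes e_\nu\otimes\eta)=e_1^{\otimes j}\otimes e_{i+1}\otimes e_\nu\otimes\eta$ for $j\ge0$, $1\le i\le n-1$, $\nu\in F_n^+$. When this map is bounded, $W_L$ also denotes its bounded extension to $\mathcal{F}^2_n\otimes\mathcal{E}$. $(W,T)$ with $T=(T_1,\dots,T_n)$ is a representation of the odometer semigroup $O_n$ if $WT_i=T_{i+1}$ for $1\le i\le n-1$ and $WT_n=T_1W$. An isometric Fock representation is a representation $(W,S^{\mathcal{E}})$ with $W$ an isometry on $\mathcal{F}^2_n\otimes\mathcal{E}$. An isometric Fock representation $(W,S^{\mathcal{E}})$ is a Nica-covariant representation of $O_n$ if $W^*(S_1\otimes I_{\mathcal{E}})=(S_n\otimes I_{\mathcal{E}})W^*$. *)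

(* Defs.v *)
From HB Require Import structures.
From mathcomp Require Import all_boot all_order all_algebra.
From mathcomp Require Import spectral sesquilinear complex.
From mathcomp Require Import all_classical all_reals all_analysis.
Import numFieldNormedType.Exports.

Set Implicit Arguments.
Unset Strict Implicit.
Unset Printing Implicit Defensive.

Import Order.TTheory GRing.Theory Num.Theory.

Local Open Scope classical_set_scope.
Local Open Scope ring_scope.

(* Complex separable Hilbert spaces. The inner product is linear in its first
   argument and conjugate-linear in the second one. The norm takes its values
   in [R[i]]. *)
HB.mixin Record CompleteNormedModule_isHilbert (R : realType) (V : Type)
    & CompleteNormedModule R[i] V := {
  hdot : {dot V for Num.conj} ;
  hdot_norm : forall x : V, hdot x x = `|x| ^+ 2 ;
  hilbert_separable : exists2 D : set V, countable D & dense D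
}.

#[short(type="hilbertType")]
HB.structure Definition Hilbert (R : realType) :=
  {V of CompleteNormedModule_isHilbert R V & CompleteNormedModule R[i] V}.

Local Notation "''[' x , y ]" := (hdot x y) : ring_scope.

Section Operators.
Variable R : realType.
Implicit Types U V : hilbertType R.

Definition lin_span V (I : Type) (f : I -> V) : set V :=
  range (fun l : seq (R[i] * I) => \sum_(p <- l) p.1 *: f p.2).

(* For a linear map this says that [`|A x| <= r * `|x|] for some real [r] and
   all [x], see [linear_boundedP]. *)
Definition bounded_op U V (A : {linear U -> V}) : Prop :=
  bounded_near A (nbhs (0 : U)).

Definition isometric_op U V (A : {linear U -> V}) : Prop :=
  forall x, `|A x| = `|x|.

Definition adjoint_op U V (A : {linear U -> V}) (B : {linear V -> U}) : Prop :=
  forall x y, '[A x, y] = '[x, B y].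

End Operators.

(* The Hilbert space tensor product, given by its elementary tensors. It is
   determined up to a unique unitary that preserves them. *)
Record hilbertTensor (R : realType) (U V : hilbertType R) := HilbertTensor {
  htens_space :> hilbertType R ;
  htens : {bilinear U -> V -> htens_space} ;
  htens_dot : forall x x' y y',
    '[htens x y, htens x' y'] = '[x, x'] * '[y, y'] ;
  htens_total : dense (lin_span (fun p : U * V => htens p.1 p.2))
}.

(* The Hilbert space direct sum, over k, of the k-fold tensor powers of C^n:
   [ftens [:: v_1; ..; v_k]] is the elementary tensor of v_1, ..., v_k, and
   [ftens [::]] is the vacuum vector. *)
Record fockSpace (R : realType) (n : nat) := FockSpace {
  fock_space :> hilbertType R ;
  ftens : seq 'rV[R[i]]_n -> fock_space ;
  ftens_multilinear : forall s s' (a : R[i]) v w,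
    ftens (s ++ (a *: v + w) :: s') =
    a *: ftens (s ++ v :: s') + ftens (s ++ w :: s') ;
  ftens_dot : forall s s',
    '[ftens s, ftens s'] =
    if size s == size s' then \prod_(p <- zip s s') dotmx p.1 p.2 else 0 ;
  ftens_total : dense (lin_span ftens)
}.

Section Odometer.
Variables (R : realType) (n : nat) (F : fockSpace R n).

Definition vacuum : F := ftens F [::].

(* Elements of the free semigroup are words in ['I_n]; the letter [g_i] is the
   ordinal [i - 1]. *)
Definition fock_basis (mu : seq 'I_n) : F :=
  ftens F [seq delta_mx 0 i | i <- mu].

Definition creation_op (i : 'I_n) (S : {linear F -> F}) : Prop :=
  bounded_op S /\ forall s, S (ftens F s) = ftens F (delta_mx 0 i :: s).

Variables (E : hilbertType R) (FE : hilbertTensor F E).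

Local Notation "f '\ot' eta" := (htens FE f eta)
  (at level 40, left associativity).

(* [SE] is the tuple [S_1 \ot I, ..., S_n \ot I], where the [S_i] are the
   creation operators. *)
Definition ampliated_creation_ops (SE : 'I_n -> {linear FE -> FE}) : Prop :=
  forall i, exists2 S : {linear F -> F}, creation_op i S &
    bounded_op (SE i) /\ forall f eta, SE i (f \ot eta) = S f \ot eta.

Variable n_gt0 : (0 < n)%N.

Definition first_letter : 'I_n := Ordinal n_gt0.
Definition last_letter : 'I_n := rev_ord first_letter.

Variable SE : 'I_n -> {linear FE -> FE}.

(* [W] is the bounded extension of the odometer map of [L], whose values on the
   vectors [fock_basis mu \ot eta] are prescribed below. In particular the
   odometer map is bounded. *)
Definition odometer_map (L : {linear E -> FE}) (W : {linear FE -> FE}) : Prop :=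
  [/\ bounded_op W,
      forall eta, W (vacuum \ot eta) = L eta,
      forall m eta, (1 <= m)%N ->
        W (fock_basis (nseq m last_letter) \ot eta) =
        iter m (SE first_letter) (L eta) &
      forall j (i i' : 'I_n) nu eta, i' = i.+1 :> nat ->
        W (fock_basis (nseq j last_letter ++ i :: nu) \ot eta) =
        fock_basis (nseq j first_letter ++ i' :: nu) \ot eta].

Definition odometer_representation (W : {linear FE -> FE})
    (T : 'I_n -> {linear FE -> FE}) : Prop :=
  (forall (i i' : 'I_n) x, i' = i.+1 :> nat -> W (T i x) = T i' x) /\
  (forall x, W (T last_letter x) = T first_letter (W x)).

Definition isometric_fock_representation (W : {linear FE -> FE}) : Prop :=
  isometric_op W /\ odometer_representation W SE.

Definition nica_covariant (W : {linear FE -> FE}) : Prop :=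
  isometric_fock_representation W /\
  exists2 Wstar : {linear FE -> FE}, adjoint_op W Wstar &
    forall x, Wstar (SE first_letter x) = SE last_letter (Wstar x).

End Odometer.

(* Main.v *)
(* The ranges of the [S_i] and the subspace [Omega \ot E] are pairwise
   orthogonal and span [F \ot E]. If [W^* S_1 = S_n W^*], then
   [L eta = W (Omega \ot eta)] is orthogonal to each [S_i x]: for [i = 1] move
   [W] across, and for [i > 1] write [S_i = W S_{i-1}] and use that [W] is an
   isometry. Hence [L eta] lies in [Omega \ot E]. Conversely, the identity
   [W^* S_1 y = S_n W^* y] is tested against [Omega \ot eta] and [S_i x]. *)
From HB Require Import structures.
Require Import Defs.
From mathcomp Require Import all_boot all_order all_algebra.
From mathcomp Require Import spectral sesquilinear complex ring lra.
From mathcomp Require Import all_classical all_reals all_analysis.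
Import numFieldNormedType.Exports.

Set Implicit Arguments.
Unset Strict Implicit.
Unset Printing Implicit Defensive.

Import Order.TTheory GRing.Theory Num.Theory.

Local Open Scope classical_set_scope.
Local Open Scope ring_scope.
Local Open Scope complex_scope.

(** * Hilbert space geometry: Cauchy-Schwarz, Riesz representation, totality *)

Section InnerProduct.
Variables (R : realType) (V : hilbertType R).
Implicit Types (x y z : V) (a : R[i]) (t : R).

Lemma hdotC x y : hdot x y = Num.conj (hdot y x).
Proof. by rewrite (hermC (@hdot R V)) expr0 mul1r. Qed.

Lemma hdot_swap x y (x' y' : V) :
  hdot x y = hdot x' y' -> hdot y x = hdot y' x'.
Proof. by rewrite (hdotC y) (hdotC y') => ->. Qed.

Lemma hdotDl x y z : hdot (x + y) z = hdot x z + hdot y z.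
Proof. exact: linearDl. Qed.

Lemma hdotZl a x y : hdot (a *: x) y = a * hdot x y.
Proof. exact: linearZl_LR. Qed.

Lemma hdotDr x y z : hdot x (y + z) = hdot x y + hdot x z.
Proof. exact: linearDr. Qed.

Lemma hdotZr a x y : hdot x (a *: y) = Num.conj a * hdot x y.
Proof. exact: linearZr_LR. Qed.

Lemma hdot0l x : hdot 0 x = 0.
Proof. exact: linear0l. Qed.

Lemma hdot0r x : hdot x 0 = 0.
Proof. exact: linear0r. Qed.

Lemma hdotBr x y z : hdot x (y - z) = hdot x y - hdot x z.
Proof. exact: linearBr. Qed.

Lemma hdot_eq0 x : hdot x x = 0 -> x = 0.
Proof. by move/eqP; rewrite hdot_norm expf_eq0/= normr_eq0 => /eqP. Qed.

(** The inner product of the underlying real Hilbert space. With [rnorm] it moves estimates from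
    [R[i]], which is only partially ordered, to [R]. *)
Definition rdot x y : R := complex.Re (hdot x y).
Definition rnorm x : R := complex.Re `|x|.

Lemma rnormE x : `|x| = (rnorm x)%:C.
Proof. by rewrite RRe_real// ger0_real. Qed.

Lemma rnorm_ge0 x : 0 <= rnorm x.
Proof. by rewrite -ler0c -rnormE. Qed.

Lemma rnorm_eq0 x : rnorm x = 0 -> x = 0.
Proof. by move=> x0; apply/eqP; rewrite -normr_eq0 rnormE x0. Qed.

Lemma rdot_rnorm x : rdot x x = rnorm x ^+ 2.
Proof. by rewrite /rdot hdot_norm rnormE -rmorphXn. Qed.

Lemma rdotC x y : rdot x y = rdot y x.
Proof. by rewrite /rdot hdotC; case: (hdot y x) => a b. Qed.

Lemma rdotDl x y z : rdot (x + y) z = rdot x z + rdot y z.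
Proof. by rewrite /rdot hdotDl; case: (hdot x z) (hdot y z) => ? ? [? ?]. Qed.

Lemma rdotZl t x y : rdot (t%:C *: x) y = t * rdot x y.
Proof.
by rewrite /rdot hdotZl; case: (hdot x y) => a b /=; rewrite mul0r subr0.
Qed.

Lemma rdotNl x y : rdot (- x) y = - rdot x y.
Proof. by rewrite -scaleN1r -(rmorphN1 (real_complex R)) rdotZl mulN1r. Qed.

Lemma rdotDr x y z : rdot z (x + y) = rdot z x + rdot z y.
Proof. by rewrite rdotC rdotDl !(rdotC z). Qed.

Lemma rdotZr t x y : rdot y (t%:C *: x) = t * rdot y x.
Proof. by rewrite rdotC rdotZl (rdotC y). Qed.

Lemma rdotNr x y : rdot y (- x) = - rdot y x.
Proof. by rewrite rdotC rdotNl (rdotC y). Qed.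

(** Cauchy-Schwarz, by expanding the square of the norm of [|y| x - |x| y]. *)
Lemma rdot_le x y : rdot x y <= rnorm x * rnorm y.
Proof.
have [x0|xn0] := eqVneq (rnorm x) 0.
  by rewrite x0 mul0r /rdot (rnorm_eq0 x0) hdot0l.
have [y0|yn0] := eqVneq (rnorm y) 0.
  by rewrite y0 mulr0 /rdot (rnorm_eq0 y0) hdot0r.
have xy_gt0 : 0 < rnorm x * rnorm y.
  by rewrite mulr_gt0// lt_neqAle rnorm_ge0 eq_sym ?xn0 ?yn0.
rewrite -(ler_pM2l xy_gt0).
have : 0 <= rdot ((rnorm y)%:C *: x - (rnorm x)%:C *: y)
                 ((rnorm y)%:C *: x - (rnorm x)%:C *: y).
  by rewrite rdot_rnorm sqr_ge0.
rewrite !(rdotDl, rdotDr, rdotNl, rdotNr, rdotZl, rdotZr) !rdot_rnorm.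
rewrite (rdotC y x).
by move: (rdot x y) => d; nra.
Qed.

Lemma hilbert_complete (u : nat -> V) :
  (forall e : R, 0 < e -> exists N : nat, forall k : nat, (N <= k)%N ->
     rnorm (u k - u N) < e) ->
  exists g : V, forall e : R, 0 < e -> exists N : nat,
    forall k : nat, (N <= k)%N -> rnorm (u k - g) < e.
Proof.
move=> u_cauchy.
have toC (e : R[i]) : 0 < e -> exists2 e' : R, 0 < e' & e = e'%:C.
  move=> e0; have eE := RRe_real (gtr0_real e0).
  by exists (complex.Re e); rewrite ?eE// -ltcR eE.
have cu : cauchy (u @ \oo).
  apply: cauchy_exP => _/posnumP[e].
  have [e' e'0 eE] := toC e%:num ltac:(by []).
  have [N uN] := u_cauchy _ e'0; exists (u N); exists N => // k /= Nk.
  rewrite -ball_normE /ball_/= distrC rnormE eE ltcR.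
  exact: uN.
have ug : u @ \oo --> lim (u @ \oo) by exact: cauchy_cvg.
exists (lim (u @ \oo)) => e e0.
have := @cvgr_dist_lt _ _ _ _ _ _ _ ug e%:C.
rewrite -(rmorph0 (real_complex R)) ltcR => /(_ _ e0)[N _ uN].
exists N => k Nk; rewrite -ltcR -rnormE distrC; exact: uN.
Qed.

(** First-order condition at a minimum: the linear term of the variation vanishes. *)
Lemma quadratic_ge0_lin_eq0 (q c : R) : 0 <= q ->
  (forall t : R, 0 <= 2 * t * c + t ^+ 2 * q) -> c = 0.
Proof.
(* Dividing by [q + 1] rather than [q] also covers [q = 0]. *)
move=> q0 /(_ (- c / (q + 1))).
have q1 : 0 < q + 1 by rewrite ltr_wpDl.
have -> : 2 * (- c / (q + 1)) * c + (- c / (q + 1)) ^+ 2 * q =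
          - (c ^+ 2 * (q + 2) / (q + 1) ^+ 2).
  by field; rewrite gt_eqF.
rewrite oppr_ge0 pmulr_lle0 ?invr_gt0 ?exprn_gt0// => h.
apply/eqP; rewrite -sqrf_eq0 eq_le sqr_ge0 andbT.
by rewrite -(@pmulr_lle0 _ (q + 2))// ltr_wpDl.
Qed.

(* The representing vector minimizes [|x|^2 - 2 f x]; by the parallelogram law
   minimizing sequences are Cauchy. *)
Lemma riesz_real (f : V -> R) (M : R) :
  (forall x y, f (x + y) = f x + f y) ->
  (forall t x, f (t%:C *: x) = t * f x) ->
  (forall x, f x <= M * rnorm x) ->
  exists g, forall x, f x = rdot x g.
Proof.
move=> fD fZ fM.
pose J x := rnorm x ^+ 2 - 2 * f x.
have lbJ x : - M ^+ 2 <= J x.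
  have := fM x; rewrite /J; move: (rnorm x) (f x) => p fx.
  have := sqr_ge0 (p - M); nra.
have infJ : has_inf (range J).
  split; first by exists (J 0), 0.
  by exists (- M ^+ 2) => _ [x _ <-].
set m := inf (range J).
have mJ x : m <= J x by apply: ge_inf; [exact: infJ.2 | exists x].
have /choice[u uJ] (k : nat) : exists x, J x < m + k.+1%:R^-1.
  have [_ [x _ <-] ?] : exists2 y, range J y & y < m + k.+1%:R^-1.
    by apply: inf_adherent => //; rewrite invr_gt0.
  by exists x.
(* The linear parts of the three [J] terms cancel. *)
have parallelogram x y : rnorm (x - y) ^+ 2 =
    2 * J x + 2 * J y - 4 * J ((2^-1)%:C *: (x + y)).
  rewrite /J fZ fD -!rdot_rnorm.
  rewrite !(rdotDl, rdotDr, rdotNl, rdotNr, rdotZl, rdotZr) (rdotC y x).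
  by field.
have small (e : R) : 0 < e ->
    exists N : nat, forall k : nat, (N <= k)%N -> k.+1%:R^-1 < e.
  by move=> e0; have [N _ NP] := near_infty_natSinv_lt (PosNum e0); exists N.
have /hilbert_complete[g ug] : forall e : R, 0 < e -> exists N : nat,
    forall k : nat, (N <= k)%N -> rnorm (u k - u N) < e.
  (* Both [J] values lie within [e ^+ 2 / 4] of [m] and the midpoint value is at least [m], so the
     squared distance is below [e ^+ 2]. *)
  move=> e e0; have e24 : 0 < e ^+ 2 / 4 by rewrite divr_gt0 ?exprn_gt0.
  have [N NP] := small _ e24; exists N => k Nk.
  rewrite -(@ltr_pXn2r _ 2)// ?nnegrE ?rnorm_ge0 ?(ltW e0)// parallelogram.
  have := NP _ Nk; have := NP _ (leqnn N); have := uJ k; have := uJ N.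
  have := mJ ((2^-1)%:C *: (u k + u N)); move: (J _) => Jz.
  move: (N.+1%:R^-1) (k.+1%:R^-1) (e ^+ 2) => dN dk ee; lra.
exists g => h; apply/esym/eqP; rewrite -subr_eq0; apply/eqP.
apply: (@quadratic_ge0_lin_eq0 (rnorm h ^+ 2)); first exact: sqr_ge0.
move=> t; apply/ler_addgt0Pr => e e0.
(* Minimality at [u k] costs less than [e / (1 + b)]; replacing [u k] by [g] costs at most
   [b * (e / (1 + b))]. Together they make [e]. *)
set b := 2 * `|t| * rnorm h.
have b0 : 0 <= b by rewrite !mulr_ge0 ?rnorm_ge0.
have e10 : 0 < e / (1 + b) by rewrite divr_gt0// ltr_pwDl.
have [N1 N1P] := small _ e10.
have [N2 N2P] := ug _ e10.
pose k := maxn N1 N2.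
have k1 := N1P k (leq_maxl _ _).
have k2 := N2P k (leq_maxr _ _).
have := mJ (u k + t%:C *: h); have := uJ k.
rewrite /J fD fZ -!rdot_rnorm.
rewrite !(rdotDl, rdotDr, rdotZl, rdotZr) (rdotC h (u k)).
have -> : rdot (u k) h = rdot h g + rdot h (u k - g).
  by rewrite rdotDr rdotNr (rdotC (u k)); ring.
have dh : 2 * t * rdot h (u k - g) <= b * (e / (1 + b)).
  have -> : 2 * t * rdot h (u k - g) = rdot ((2 * t)%:C *: h) (u k - g).
    by rewrite rdotZl.
  apply: le_trans (rdot_le _ _) _.
  have -> : rnorm ((2 * t)%:C *: h) = b.
    apply: complexI; rewrite -rnormE normrZ normc_def rnormE -rmorphM /=.
    by rewrite expr0n addr0 sqrtr_sqr normrM ger0_norm.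
  by rewrite ler_wpM2l// ltW.
have : b * (e / (1 + b)) + e / (1 + b) = e by field; rewrite gt_eqF// ltr_pwDl.
move: k1 dh; move: (k.+1%:R^-1) (e / _) => dk eb; lra.
Qed.

(** The vector representing the real part of [f] represents [f], since the real part of [f (i x)] is
    minus the imaginary part of [f x]. *)
Lemma riesz (f : V -> R[i]) (M : R) :
  (forall x y, f (x + y) = f x + f y) ->
  (forall a x, f (a *: x) = a * f x) ->
  (forall x, complex.Re (f x) <= M * rnorm x) ->
  exists g, forall x, f x = hdot x g.
Proof.
move=> fD fZ fM.
have [|||g gP] := @riesz_real (fun x => complex.Re (f x)) M.
- by move=> x y; rewrite fD; case: (f x) (f y) => ? ? [].
- by move=> t x; rewrite fZ; case: (f x) => ? ? /=; rewrite mul0r subr0.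
- exact: fM.
exists g => x.
apply/eqP; rewrite eq_complex; apply/andP; split; first by rewrite (gP x).
have := gP (Complex 0 1 *: x); rewrite /rdot hdotZl fZ.
case: (f x) (hdot x g) => a b [c d] /=.
by rewrite !mul0r !mul1r !sub0r => /oppr_inj ->.
Qed.

(** If [z] were nonzero, some [v] in the span would satisfy [|z - v| < |z|]; as [v] is orthogonal to
    [z], Cauchy-Schwarz gives [|z|^2 <= |z - v| |z| < |z|^2]. *)
Lemma orthogonal_dense_eq0 (I : Type) (b : I -> V) z :
  dense (lin_span b) -> (forall i, hdot (b i) z = 0) -> z = 0.
Proof.
move=> b_dense bz; apply: contrapT => z0.
have nz : 0 < rnorm z.
  by rewrite lt_neqAle rnorm_ge0 eq_sym andbT; apply/eqP => /rnorm_eq0.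
have [||v [/= zv [l _ lv]]] := b_dense (ball z `|z|).
- by exists z; apply: ballxx; rewrite normr_gt0; apply/eqP.
- by apply: ball_open; rewrite normr_gt0; apply/eqP.
have vz : hdot v z = 0.
  rewrite -lv; elim: l {lv} => [|p l IH]; first by rewrite big_nil hdot0l.
  by rewrite big_cons hdotDl hdotZl bz mulr0 add0r.
move: zv; rewrite -ball_normE /ball_/= !rnormE ltcR => zv.
have := rdot_le (z - v) z.
rewrite rdotDl rdotNl [rdot v z]/rdot vz subr0 rdot_rnorm expr2.
by rewrite ler_pM2r// leNgt zv.
Qed.

End InnerProduct.

(** * Adjoints and isometries *)

Section Operators.
Variables (R : realType) (U V : hilbertType R).

Lemma bounded_op_rnorm (A : {linear U -> V}) : bounded_op A ->
  exists2 M : R, 0 <= M & forall x, rnorm (A x) <= M * rnorm x.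
Proof.
move=> /linear_boundedP[M [Mreal MP]].
have M1 : M < `|M| + 1 by rewrite ltr_pwDr// real_ler_norm.
exists (complex.Re (`|M| + 1)).
  by rewrite -ler0c RRe_real ?ger0_real ?addr_ge0.
move=> x; have := MP _ M1 x; rewrite !rnormE.
by rewrite -[X in X * _]RRe_real ?ger0_real ?addr_ge0// -rmorphM lecR.
Qed.

Lemma adjoint_op_exists (A : {linear U -> V}) : bounded_op A ->
  exists B : {linear V -> U}, adjoint_op A B.
Proof.
move=> /bounded_op_rnorm[M M0 AM].
have /choice[B BP] (y : V) : exists g : U, forall x, hdot (A x) y = hdot x g.
  apply: (@riesz _ _ _ (M * rnorm y)).
  - by move=> x x'; rewrite linearD hdotDl.
  - by move=> a x; rewrite linearZ hdotZl.
  - move=> x; apply: le_trans (rdot_le _ _) _.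
    by rewrite mulrAC ler_wpM2r ?rnorm_ge0.
have Blin : linear B.
  (* Uniqueness of the representing vector: the defect of linearity is orthogonal to every vector,
     hence to itself. *)
  move=> a y z; apply/eqP; rewrite -subr_eq0; apply/eqP; apply: hdot_eq0.
  rewrite hdotBr -BP !hdotDr !hdotZr !BP; exact: subrr.
pose mB := GRing.isLinear.Build _ _ _ _ B Blin.
pose B' : {linear V -> U} := HB.pack B mB.
by exists B' => x y; rewrite BP.
Qed.

(** Polarization: [x + y] gives the real part, and [i x] in place of [x] the imaginary part. *)
Lemma isometric_op_dot (A : {linear U -> V}) : isometric_op A ->
  forall x y, hdot (A x) (A y) = hdot x y.
Proof.
move=> Aiso.
have rA x y : rdot (A x) (A y) = rdot x y.
  have nA z : rdot (A z) (A z) = rdot z z by rewrite !rdot_rnorm /rnorm Aiso.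
  have := nA (x + y); rewrite linearD !(rdotDl, rdotDr) !nA.
  rewrite (rdotC y x) (rdotC (A y)); lra.
move=> x y.
apply/eqP; rewrite eq_complex; apply/andP; split; first exact/eqP/rA.
have := rA (Complex 0 1 *: x) y; rewrite /rdot linearZ !hdotZl.
case: (hdot (A x) (A y)) (hdot x y) => a b [c d] /=.
by rewrite !mul0r !mul1r !sub0r => /oppr_inj ->.
Qed.

End Operators.

(** * Creation operators on the ampliated Fock space *)

Section FockTensor.
Variables (R : realType) (n : nat) (F : fockSpace R n).
Variables (E : hilbertType R) (FE : hilbertTensor F E).

Local Notation "f '\ot' eta" := (htens FE f eta)
  (at level 40, left associativity).

Lemma dotmx_delta (i j : 'I_n) :
  dotmx (delta_mx 0 i) (delta_mx 0 j) = (i == j)%:R :> R[i].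
Proof.
rewrite dotmxE mxE (bigD1 i)//= big1 => [|k ki]; rewrite !mxE ?eqxx/=.
  by rewrite addr0 mul1r; case: eqP; rewrite ?conjC1 ?conjC0.
by rewrite (negPf ki) mul0r.
Qed.

Lemma ftens0 s : ftens F (0 :: s) = 0.
Proof.
have := ftens_multilinear F [::] s 1 0 0.
by rewrite scaler0 addr0 scale1r /= -{1}[ftens F _]addr0 => /addrI <-.
Qed.

(** Creation operators only prepend basis vectors; this expansion brings every nonempty tensor into
    the sum of their ranges. *)
Lemma ftens_cons (v : 'rV[R[i]]_n) s :
  ftens F (v :: s) = \sum_i v 0 i *: ftens F (delta_mx 0 i :: s).
Proof.
rewrite {1}(row_sum_delta v); elim: index_enum => [|j r IH].
  by rewrite !big_nil ftens0.
by rewrite !big_cons -IH; apply: (ftens_multilinear F [::]).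
Qed.

Lemma rnorm_htens f eta : rnorm (f \ot eta) = rnorm f * rnorm eta.
Proof.
apply/eqP; rewrite -(@eqrXn2 _ 2) ?mulr_ge0 ?rnorm_ge0// exprMn -!rdot_rnorm.
by rewrite /rdot htens_dot !hdot_norm !rnormE -!rmorphXn -rmorphM.
Qed.

(** For fixed [eta], Riesz turns [f |-> <f \ot eta, z>] into pairing with some [g]; totality of
    [ftens] gives [g = 0], and totality of elementary tensors then gives [z = 0]. *)
Lemma tensor_ftens_orthogonal_eq0 (z : FE) :
  (forall s eta, hdot (ftens F s \ot eta) z = 0) -> z = 0.
Proof.
move=> sz; apply: (orthogonal_dense_eq0 (@htens_total _ _ _ FE)) => -[f eta] /=.
have [|||g gP] :=
    @riesz _ _ (fun f => hdot (f \ot eta) z) (rnorm eta * rnorm z).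
- by move=> x y; rewrite linearDl hdotDl.
- by move=> a x; rewrite linearZl_LR hdotZl.
- move=> x; apply: le_trans (rdot_le _ _) _.
  by rewrite rnorm_htens -mulrA mulrC.
rewrite gP (_ : g = 0) ?hdot0r//.
by apply: (orthogonal_dense_eq0 (@ftens_total _ _ F)) => s; rewrite -gP.
Qed.

(** With the adjoint [B] of [A], the claim is the vector identity [B w = z], which can be tested on
    a total family. *)
Lemma tensor_dot_ext (A : {linear FE -> FE}) (w z : FE) : bounded_op A ->
  (forall s eta, hdot (A (ftens F s \ot eta)) w = hdot (ftens F s \ot eta) z) ->
  forall x, hdot (A x) w = hdot x z.
Proof.
move=> /adjoint_op_exists[B BP] Az x.
rewrite BP (_ : B w = z)//; apply/eqP; rewrite -subr_eq0; apply/eqP.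
by apply: tensor_ftens_orthogonal_eq0 => s eta; rewrite hdotBr -BP Az subrr.
Qed.

Variable SE : 'I_n -> {linear FE -> FE}.
Hypothesis SEP : ampliated_creation_ops SE.

Lemma creation_bounded i : bounded_op (SE i).
Proof. by have [? _ []] := SEP i. Qed.

Lemma creation_ftens i s eta :
  SE i (ftens F s \ot eta) = ftens F (delta_mx 0 i :: s) \ot eta.
Proof. by have [S [_ SP] [_ ->]] := SEP i; rewrite SP. Qed.

Lemma creation_vacuum_dot i x eta : hdot (SE i x) (vacuum F \ot eta) = 0.
Proof.
rewrite -[RHS](hdot0r x); apply: (tensor_dot_ext (creation_bounded i)).
by move=> s eta'; rewrite creation_ftens htens_dot ftens_dot mul0r hdot0r.
Qed.

Lemma vacuum_creation_dot i x eta : hdot (vacuum F \ot eta) (SE i x) = 0.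
Proof.
by rewrite -(hdot0l (vacuum F \ot eta)); apply: hdot_swap;
  rewrite creation_vacuum_dot hdot0r.
Qed.

(** The relations [S_i^* S_j = delta_ij I], checked on elementary tensors and extended one slot at a
    time. The scalar sits on the right vector to fit [tensor_dot_ext]. *)
Lemma creation_dot i j x y :
  hdot (SE i x) (SE j y) = hdot x ((i == j)%:R *: y).
Proof.
have scale_dot (b : bool) (u v : FE) : hdot (b%:R *: u) v = hdot u (b%:R *: v).
  by case: b; rewrite ?scale1r ?scale0r ?hdot0l ?hdot0r.
have dot_ftens k l s eta s' eta' :
    hdot (SE k (ftens F s \ot eta)) (SE l (ftens F s' \ot eta')) =
    hdot (ftens F s \ot eta) ((k == l)%:R *: (ftens F s' \ot eta')).
  rewrite !creation_ftens -scale_dot hdotZl !htens_dot !ftens_dot /= eqSS.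
  case: (size s == _); last by rewrite !mul0r mulr0.
  by rewrite big_cons /= dotmx_delta mulrA.
have dot_ftensl s eta y' : hdot (SE i (ftens F s \ot eta)) (SE j y') =
    hdot (ftens F s \ot eta) ((i == j)%:R *: y').
  apply: hdot_swap; rewrite scale_dot.
  apply: (tensor_dot_ext (creation_bounded j)) => s' eta'.
  by rewrite dot_ftens eq_sym.
by apply: (tensor_dot_ext (creation_bounded i)) => s eta; rewrite dot_ftensl.
Qed.

Lemma creation_vacuum_orthogonal_eq0 (z : FE) :
  (forall eta, hdot (vacuum F \ot eta) z = 0) ->
  (forall i x, hdot (SE i x) z = 0) -> z = 0.
Proof.
move=> vz cz; apply: tensor_ftens_orthogonal_eq0 => -[|v s] eta.
  exact: vz.
have -> : ftens F (v :: s) \ot eta = \sum_i v 0 i *: SE i (ftens F s \ot eta).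
  rewrite ftens_cons linear_sumlz; apply: eq_bigr => i _.
  by rewrite linearZl_LR creation_ftens.
elim: index_enum => [|i r IH]; first by rewrite big_nil hdot0l.
by rewrite big_cons hdotDl hdotZl cz mulr0 add0r.
Qed.

End FockTensor.

(** * Nica covariance and the range of [L] *)

Theorem theorem1p6 (R : realType) (n : nat) (n_gt0 : (0 < n)%N)
    (F : fockSpace R n) (E : hilbertType R) (FE : hilbertTensor F E)
    (SE : 'I_n -> {linear FE -> FE}) (L : {linear E -> FE})
    (W : {linear FE -> FE}) :
  ampliated_creation_ops SE ->
  bounded_op L ->
  odometer_map n_gt0 SE L W ->
  isometric_fock_representation n_gt0 SE W ->
  nica_covariant n_gt0 SE W <->
  range L `<=` range (fun xi : E => htens FE (vacuum F) xi).
Proof.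
move=> SEP Lbdd [Wbdd WL _ _] Wrep; have [Wiso [WS Wlast]] := Wrep.
have Wdot := isometric_op_dot Wiso.
split=> [[_ [Wstar WstarP nica]] | Lvac].
  move=> _ [eta _ <-].
  have Lorth i x : hdot (SE i x) (L eta) = 0.
    rewrite -WL; have [i0|i_gt0] := posnP i.
      have -> : i = first_letter n_gt0 by apply: val_inj.
      rewrite -(hdot0l (W (htens FE (vacuum F) eta))); apply: hdot_swap.
      by rewrite WstarP nica (vacuum_creation_dot SEP) hdot0r.
    (* Letters count from 0, so a nonzero [i] has the predecessor letter [i.-1], and [W] carries its
       creation operator to that of [i]. *)
    have lt_i1 : (i.-1 < n)%N by rewrite (leq_ltn_trans (leq_pred i)).
    rewrite -(WS (Ordinal lt_i1)) /= ?prednK// Wdot.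
    exact: (creation_vacuum_dot SEP).
  (* Riesz on [E] produces [xi] for which [Omega \ot xi] is the orthogonal projection of [L eta]
     onto [Omega \ot E]. *)
  have [|||xi xiP] :=
      @riesz _ _ (fun xi => hdot (htens FE (vacuum F) xi) (L eta))
        (rnorm (L eta) * rnorm (vacuum F)).
  - by move=> u v; rewrite linearDr hdotDl.
  - by move=> a u; rewrite linearZr_LR hdotZl.
  - by move=> u; apply: le_trans (rdot_le _ _) _;
      rewrite rnorm_htens mulrC mulrA.
  exists xi => //; apply/esym/eqP; rewrite -subr_eq0; apply/eqP.
  apply: (creation_vacuum_orthogonal_eq0 SEP) => [eta'|i x]; rewrite hdotBr.
    by rewrite xiP htens_dot ftens_dot eqxx/= big_nil mul1r subrr.
  by rewrite Lorth (creation_vacuum_dot SEP) subrr.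
have [Wstar WstarP] := adjoint_op_exists Wbdd.
split=> //; exists Wstar => // y.
apply/eqP; rewrite -subr_eq0; apply/eqP.
apply: (creation_vacuum_orthogonal_eq0 SEP) => [eta|i x];
  rewrite hdotBr -WstarP.
  (* Against the vacuum both terms vanish, since [W (Omega \ot eta) = L eta] is again in
     [Omega \ot E]. *)
  have [xi _ xiE] := Lvac _ (ex_intro2 _ _ eta I erefl).
  by rewrite WL -xiE !(vacuum_creation_dot SEP) subrr.
(* Below the last letter [W S_i = S_{i+1}]; both terms vanish because [i + 1] is not the first
   letter and [i] is not the last. *)
have [lt_i1|ge_i1] := ltnP i.+1 n.
  rewrite (WS i (Ordinal lt_i1))// !(creation_dot SEP).
  have -> : (i == last_letter n_gt0) = false.
    by rewrite -val_eqE /= subn1 ltn_eqF// -ltnS prednK.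
  by rewrite !scale0r !hdot0r subrr.
have -> : i = last_letter n_gt0.
  apply: val_inj => /=; apply/eqP.
  by rewrite subn1 eqn_leq -ltnS prednK// ltn_ord -ltnS prednK.
(* With [W S_n = S_1 W], both terms equal [<W x, y> = <x, W^* y>]. *)
by rewrite Wlast !(creation_dot SEP) !eqxx !scale1r WstarP subrr.
Qed.
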